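(* Let $K$ be an abstract elementary class and let $\lambda > \mathrm{LS}(K)$. If $K$ is semisolvable in $\lambda$, then for all cardinals $\mu, \kappa$ and every $M \in K$ of cardinality $\lambda$, $M$ does not have the $(\kappa,\mu)$-order property of length $\left((\mu + \mathrm{LS}(K))^{\kappa}\right)^+$.
   Context: $K$ is an AEC with vocabulary $\tau(K)$, strong substructure $\le_K$, Löwenheim–Skolem–Tarski number $\mathrm{LS}(K)$; $K_\lambda$ denotes the models in $K$ of cardinality $\lambda$. Galois types over sets: for $N \in K$, $A \subseteq |N|$ and a sequence $\bar b$ from $N$, $\mathrm{gtp}(\bar b/A;N)$ is the class of $(\bar b,A,N)$ under the transitive closure of: $(\bar b_1,A,N_1)\sim(\bar b_2,A,N_2)$ iff there are $N'\in K$ and $K$-embeddings $f_\ell:N_\ell\to N'$ fixing $A$ with $f_1(\bar b_1)=f_2(\bar b_2)$. EM blueprints: for $\mu\ge \mathrm{LS}(K)$, $\Upsilon_\mu[K]$ is the set of $\Phi=\{p_n:n<\omega\}$ ($p_n$ an $n$-variable quantifier-free type in a vocabulary $\tau(\Phi)\supseteq\tau(K)$, $|\tau(\Phi)|\le\mu$) such that for each linear order $I$ there is a $\tau(\Phi)$-structure $\mathrm{EM}(I,\Phi)$ generated by $I$ under the functions of $\tau(\Phi)$ with every increasing $n$-tuple from $I$ realizing $p_n$, whose $\tau(K)$-reduct $\mathrm{EM}_{\tau(K)}(I,\Phi)$ is in $K$ with cardinality $|I|+|\tau(\Phi)|+\mathrm{LS}(K)$, and with $I\subseteq J \Rightarrow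 \mathrm{EM}_{\tau(K)}(I,\Phi)\le_K\mathrm{EM}_{\tau(K)}(J,\Phi)$. $M$ is universal in $\lambda$ if $M\in K_\lambda$ and every $N \in K_\lambda$ $K$-embeds into $M$. $K$ is semisolvable in $\lambda$ if there is $\Phi\in\Upsilon_{\mathrm{LS}(K)}[K]$ such that $\mathrm{EM}_{\tau(K)}(I,\Phi)$ is universal in $\lambda$ for every linear order $I$ of cardinality $\lambda$. Order property: $N\in K$ has the $(\kappa,\mu)$-order property of length $\theta$ if there are $\langle\bar a_i:i<\theta\rangle$ with $\bar a_i\in{}^{\kappa}|N|$ and $A\subseteq|N|$ with $|A|\le\mu$ such that for all $i_0<i_1<\theta$, $j_0<j_1<\theta$: $\mathrm{gtp}(\bar a_{i_0}\bar a_{i_1}/A;N)\ne\mathrm{gtp}(\bar a_{j_1}\bar a_{j_0}/A;N)$. *)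

(* Defs.v *)
From mathcomp Require Import all_boot.
From Stdlib Require Import Relations.

Set Implicit Arguments.
Unset Strict Implicit.
Unset Printing Implicit Defensive.

(** * Cardinal comparison of types (classically: Cantor-Schroeder-Bernstein). *)
Definition card_le (A B : Type) : Prop := exists f : A -> B, injective f.
Definition card_eq (A B : Type) : Prop := card_le A B /\ card_le B A.
Definition card_lt (A B : Type) : Prop := card_le A B /\ ~ card_le B A.

Definition is_succ_card (I X : Type) : Prop :=
  card_lt X I /\
  forall S : I -> Prop, card_lt {i | S i} I -> card_le {i | S i} X.

Definition strict_total {I : Type} (R : I -> I -> Prop) : Prop :=
  (forall i, ~ R i i) /\ (forall i j k, R i j -> R j k -> R i k) /\
  (forall i j, R i j \/ i = j \/ R j i).
Definition well_order {I : Type} (R : I -> I -> Prop) : Prop :=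
  strict_total R /\ well_founded R.

Record vocab := Vocab {
  fsym : Type; farity : fsym -> nat;
  rsym : Type; rarity : rsym -> nat }.

Definition symbols (t : vocab) : Type := (fsym t + rsym t)%type.

Record Str (t : vocab) := MkStr {
  car :> Type;
  fint : forall f : fsym t, ('I_(farity f) -> car) -> car;
  rint : forall r : rsym t, ('I_(rarity r) -> car) -> Prop }.

Arguments fint {t} s f _.
Arguments rint {t} s r _.

Section Structures.
Variable t : vocab.

Definition closed (N : Str t) (A : N -> Prop) : Prop :=
  forall f (x : 'I_(farity f) -> N), (forall i, A (x i)) -> A (fint N f x).

Definition restrict (N : Str t) (A : N -> Prop) (H : @closed N A) : Str t :=
  @MkStr t {x : N | A x}
    (fun f x => exist A (fint N f (fun i => proj1_sig (x i)))
                        (H f _ (fun i => proj2_sig (x i))))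
    (fun r x => rint N r (fun i => proj1_sig (x i))).

Definition emb (M N : Str t) (g : M -> N) : Prop :=
  injective g /\
  (forall f (x : 'I_(farity f) -> M), g (fint M f x) = fint N f (fun i => g (x i))) /\
  (forall r (x : 'I_(rarity r) -> M), rint M r x <-> rint N r (fun i => g (x i))).

(** ** Abstract elementary classes.
    [K] is the class, [leK N A] means: the subset [A] of [N] is (the universe
    of) a strong substructure of [N], i.e. [N|A <=_K N]. *)
Unset Implicit Arguments.
Variables (K : Str t -> Prop) (leK : forall N : Str t, (N -> Prop) -> Prop).
Set Implicit Arguments.

(** [A <=_K B] computed inside an ambient structure [U]. *)
Definition sle (U : Str t) (A B : U -> Prop) : Prop :=
  (forall x, A x -> B x) /\
  exists HB : closed B, leK (restrict HB) (fun x => A (proj1_sig x)).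

Definition LS_prop (chi : Type) : Prop :=
  card_le nat chi /\ card_le (symbols t) chi /\
  forall N : Str t, K N -> forall A : N -> Prop,
    exists B : N -> Prop, (forall x, A x -> B x) /\ leK N B /\
      card_le {x | B x} ({x | A x} + chi)%type.

Definition is_AEC : Prop :=
  (forall (M N : Str t) (g : M -> N), emb g -> (forall y, exists x, g x = y) ->
     K M -> K N /\ forall A, leK M A -> leK N (fun y => exists x, A x /\ g x = y)) /\
  (forall (N : Str t) (A : N -> Prop), leK N A ->
     K N /\ exists H : closed A, K (restrict H)) /\
  (forall N : Str t, K N -> leK N (fun _ : N => True)) /\
  (forall (N : Str t) (A B : N -> Prop), sle A B -> leK N B -> leK N A) /\
  (forall (N : Str t) (A B : N -> Prop), (forall x, A x -> B x) ->
     closed A -> closed B -> leK N A -> leK N B -> sle A B) /\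
  (* Tarski-Vaught chain axioms (chains indexed by nonempty well-orders,
     realised inside an ambient structure [U], e.g. their union) *)
  (forall (U : Str t) (I : Type) (R : I -> I -> Prop) (A : I -> U -> Prop),
     inhabited I -> well_order R ->
     (forall i, exists H : closed (A i), K (restrict H)) ->
     (forall i j, R i j -> sle (A i) (A j)) ->
     let Un := fun x => exists i, A i x in
     (forall i, sle (A i) Un) /\
     (forall B : U -> Prop, (forall i, sle (A i) B) -> sle Un B)) /\
  (exists chi : Type, LS_prop chi).

Definition is_LS_number (chi : Type) : Prop :=
  LS_prop chi /\ forall chi' : Type, LS_prop chi' -> card_le chi chi'.

Definition kemb (M N : Str t) (g : M -> N) : Prop :=
  emb g /\ leK N (fun y => exists x, g x = y).

(** ** Galois types over sets.
    A triple [(b, A, N)] with [A] given as an abstract type [Aty] together with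
    its (injective) inclusion [ta] into [N], and a sequence [tb] indexed by [X]. *)
Record triple (Aty X : Type) := Triple {
  tN : Str t; ta : Aty -> tN; tb : X -> tN }.

Definition gtp_step (Aty X : Type) (p q : triple Aty X) : Prop :=
  K (tN p) /\ K (tN q) /\ injective (ta p) /\ injective (ta q) /\
  exists (N' : Str t) (f1 : tN p -> N') (f2 : tN q -> N'),
    K N' /\ kemb f1 /\ kemb f2 /\
    (forall a, f1 (ta p a) = f2 (ta q a)) /\
    (forall x, f1 (tb p x) = f2 (tb q x)).

Definition gtp_eq (Aty X : Type) (p q : triple Aty X) : Prop :=
  clos_refl_trans (triple Aty X) (@gtp_step Aty X) p q.

Definition concat {kappa N : Type} (a b : kappa -> N) : (kappa + kappa)%type -> N :=
  fun s => match s with inl k => a k | inr k => b k end.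

Definition order_property (N : Str t) (kappa mu I : Type) (R : I -> I -> Prop)
  : Prop :=
  exists (a : I -> kappa -> N) (A : N -> Prop),
    card_le {x | A x} mu /\
    forall i0 i1 j0 j1, R i0 i1 -> R j0 j1 ->
      ~ gtp_eq (Triple (fun x : {x | A x} => proj1_sig x) (concat (a i0) (a i1)))
               (Triple (fun x : {x | A x} => proj1_sig x) (concat (a j1) (a j0))).

Definition universal_in (M : Str t) (Lam : Type) : Prop :=
  K M /\ card_eq M Lam /\
  forall N : Str t, K N -> card_eq N Lam -> exists g : N -> M, kemb g.

End Structures.

Record expansion (t : vocab) := Expansion {
  xf : Type; xfar : xf -> nat; xr : Type; xrar : xr -> nat }.

Definition expand (t : vocab) (e : expansion t) : vocab :=
  @Vocab (fsym t + xf e)%type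
         (fun f => match f with inl f => farity f | inr f => xfar f end)
         (rsym t + xr e)%type
         (fun r => match r with inl r => rarity r | inr r => xrar r end).

Definition reduct (t : vocab) (e : expansion t) (M : Str (expand e)) : Str t :=
  @MkStr t M (fun f x => fint M (inl f) x) (fun r x => rint M (inl r) x).

Inductive term (t : vocab) (V : Type) : Type :=
| tvar : V -> term t V
| tapp : forall f : fsym t, ('I_(farity f) -> term t V) -> term t V.

Fixpoint teval (t : vocab) (V : Type) (M : Str t) (v : V -> M) (u : term t V) : M :=
  match u with
  | tvar x => v x
  | tapp f a => fint M f (fun i => @teval t V M v (a i))
  end.

Inductive qf (t : vocab) (V : Type) : Type :=
| qeq : term t V -> term t V -> qf t V
| qrel : forall r : rsym t, ('I_(rarity r) -> term t V) -> qf t V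
| qneg : qf t V -> qf t V
| qand : qf t V -> qf t V -> qf t V.

Fixpoint qsat (t : vocab) (V : Type) (M : Str t) (v : V -> M) (p : qf t V) : Prop :=
  match p with
  | qeq u w => @teval t V M v u = @teval t V M v w
  | qrel r a => rint M r (fun i => @teval t V M v (a i))
  | qneg p => ~ @qsat t V M v p
  | qand p q => @qsat t V M v p /\ @qsat t V M v q
  end.

Record blueprint (t : vocab) := Blueprint {
  bx : expansion t;
  (* p_n : a complete n-variable quantifier-free type in tau(Phi) *)
  bp : forall n : nat, qf (expand bx) 'I_n -> Prop }.

Definition tauPhi (t : vocab) (Phi : blueprint t) : vocab := expand (bx Phi).

Section EM.
Unset Implicit Arguments.
Variables (t : vocab) (K : Str t -> Prop) (leK : forall N : Str t, (N -> Prop) -> Prop).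
Set Implicit Arguments.

(** Phi in Upsilon_mu[K] (with [mu] a type of cardinality mu), except for the
    existence of the EM models, which is expressed by [EM_family]. *)
Definition blueprint_ok (mu : Type) (Phi : blueprint t) : Prop :=
  card_le (symbols (tauPhi Phi)) mu /\
  forall n (p : qf (tauPhi Phi) 'I_n), @bp t Phi n p \/ @bp t Phi n (qneg p).

Definition EM_family (chi : Type) (Phi : blueprint t)
  (EMs : forall I : Type, (I -> I -> Prop) -> Str (tauPhi Phi))
  (EMi : forall (I : Type) (R : I -> I -> Prop), I -> EMs I R) : Prop :=
  (forall (I : Type) (R : I -> I -> Prop), strict_total R ->
     injective (EMi I R) /\
     (forall S : EMs I R -> Prop, closed S -> (forall i, S (EMi I R i)) ->
        forall x, S x) /\
     (forall n (s : 'I_n -> I), (forall a b : 'I_n, a < b -> R (s a) (s b)) ->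
        forall p, @bp t Phi n p -> qsat (fun k => EMi I R (s k)) p) /\
     K (reduct (EMs I R)) /\
     card_eq (reduct (EMs I R)) (I + symbols (tauPhi Phi) + chi)%type) /\
  (forall (I J : Type) (R : I -> I -> Prop) (Q : J -> J -> Prop) (h : I -> J),
     strict_total R -> strict_total Q -> (forall i j, R i j -> Q (h i) (h j)) ->
     exists g : EMs I R -> EMs J Q,
       emb g /\ (forall i, g (EMi I R i) = EMi J Q (h i)) /\
       @kemb t leK (reduct (EMs I R)) (reduct (EMs J Q)) g).

Definition semisolvable (chi Lam : Type) : Prop :=
  exists (Phi : blueprint t)
         (EMs : forall I : Type, (I -> I -> Prop) -> Str (tauPhi Phi))
         (EMi : forall (I : Type) (R : I -> I -> Prop), I -> EMs I R),
    blueprint_ok chi Phi /\ EM_family chi EMi /\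
    forall (I : Type) (R : I -> I -> Prop), strict_total R -> card_eq I Lam ->
      universal_in K leK (reduct (EMs I R)) Lam.

End EM.

(* Main.v *)
(** Write [X := kappa -> mu + chi] and let [a i] be a sequence in [M] witnessing the
    order property. Since the [a i] are distinct and [X^kappa <= X], [X < Lam].
    Fix a well-order of [Lam] and embed [M] into its EM model; each [a i] is then
    given by terms at a tuple of elements of [Lam]. Well-orders have few
    cuts, so a pigeonhole and a closure argument yield [i0 < i1] whose tuples, at
    each coordinate, either agree or form the beginning of an increasing sequence.
    This pair can be stretched: for every linear order [J] with at most [Lam]
    elements there are a linear order [T] of size [Lam] and tuples indexed by [J]
    in it, such that any two of them, taken in increasing order, look like the pair
    [(i0, i1)] over the parameters. Take for [J] an order with more than [X]
    elements and a dense subset of size at most [X], and embed the EM model of [T] back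
    into that of [Lam] by universality. Over the image of the dense subset a
    well-order realizes at most [X] types, so two elements [j < j'] have the
    same type; comparing both with some [b] of the dense subset between them
    identifies the types of [(a i0, a i1)] and [(a i1, a i0)]. *)
From mathcomp Require Import all_boot boolp classical_sets.
From mathcomp Require wochoice.
Require Import Defs.
From mathcomp Require Import all_boot.

Set Implicit Arguments.
Unset Strict Implicit.
Unset Printing Implicit Defensive.

(** * Cardinal arithmetic *)

Lemma card_le_refl A : card_le A A.
Proof. by exists id. Qed.

Lemma card_le_trans B A C : card_le A B -> card_le B C -> card_le A C.
Proof. by move=> [f fi] [g gi]; exists (g \o f); exact: inj_comp. Qed.

Lemma card_le_sum A A' B B' :
  card_le A A' -> card_le B B' -> card_le (A + B)%type (A' + B')%type.
Proof.
move=> [f fi] [g gi].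
exists (fun x => match x with inl a => inl (f a) | inr b => inr (g b) end).
by move=> [a|b] [a'|b'] // [] => [/fi|/gi] ->.
Qed.

Lemma card_le_prod A A' B B' :
  card_le A A' -> card_le B B' -> card_le (A * B)%type (A' * B')%type.
Proof.
by move=> [f fi] [g gi]; exists (fun x => (f x.1, g x.2)) => -[a b] [a' b'] [/fi -> /gi ->].
Qed.

Lemma card_le_arrow V A B : card_le A B -> card_le (V -> A) (V -> B).
Proof.
move=> [f fi]; exists (fun h v => f (h v)) => h h' e; apply/funext => v.
by apply: fi; rewrite -[LHS]/((fun v => f (h v)) v) e.
Qed.

Lemma sig_inj A (P : A -> Prop) : injective (@proj1_sig A P).
Proof. by move=> [x Px] [y Py] /= exy; exact: eq_exist. Qed.

Lemma card_le_sig A (P : A -> Prop) : card_le {x | P x} A.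
Proof. by exists (@proj1_sig _ _); exact: sig_inj. Qed.

Lemma card_le_surj A B (f : A -> B) : (forall b, exists a, f a = b) -> card_le B A.
Proof. by move=> /choice[g fg]; exists g => x y e; rewrite -(fg x) e fg. Qed.

(** Zorn's lemma gives a maximal graph of a partial injection between [A] and [B]. If it missed a
    point [a] of [A] and a point [b] of [B], the pair [(a, b)] could be added. *)
Lemma card_le_total A B : card_le A B \/ card_le B A.
Proof.
pose P (G : set (A * B)) := forall p q, G p -> G q -> (p.1 = q.1 <-> p.2 = q.2).
have [F FP Ftot|G [GP Gmax]] := @Zorn_bigcup _ P.
  move=> p q [X FX Xp] [Y FY Yq].
  have [XY|YX] := Ftot _ _ FX FY.
    by apply: (FP _ FY) => //; exact: XY.
  by apply: (FP _ FX) => //; exact: YX.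
case: (pselect (forall a, exists b, G (a, b))) => [/choice[f fG]|/existsNP[a na]].
  by left; exists f => x y fxy; apply/(GP _ _ (fG x) (fG y)).
case: (pselect (forall b, exists a, G (a, b))) => [/choice[f fG]|/existsNP[b nb]].
  by right; exists f => x y fxy; apply/(GP _ _ (fG x) (fG y)).
case: (Gmax (G `|` [set (a, b)])%classic).
  split; first by move=> p; left.
  by move=> /(_ (a, b)) h; apply: na; exists b; apply: h; right.
move=> [x y] [x' y'] [Gp|[-> ->]] [Gq|[-> ->]] //=.
- exact: (GP _ _ Gp Gq).
- by split=> e; subst; [case: na; exists y|case: nb; exists x].
- by split=> e; subst; [case: na; exists y'|case: nb; exists x'].
Qed.

(** * Squares of infinite cardinals *)

Section Hessenberg.
Variable A : Type.
Let fld (G : set (A * A * A)) a := exists c, G (a, a, c).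
(** [good G] makes [G] the graph of an injection from [S * S] to [S], where [S] is the field of
    [G]. *)
Let good (G : set (A * A * A)) :=
  (forall p q, G p -> G q -> (p.1 = q.1 <-> p.2 = q.2)) /\
  (forall a b c, G (a, b, c) -> [/\ fld G a, fld G b & fld G c]) /\
  (forall a b, fld G a -> fld G b -> exists c, G (a, b, c)).

(** Zorn's lemma gives a maximal pairing on a subset [S] of [A]. Either the complement of [S] embeds
    in [S], and then [A] is no larger than [S + S], hence than [S]; or [S] embeds in its complement,
    and the pairing extends to a larger set. *)
Lemma card_le_square : card_le nat A -> card_le (A * A)%type A.
Proof.
move=> [e ei].
pose G0 : set (A * A * A) := fun p =>
  exists m n, p = (e m, e n, e (pickle (m, n))).
have G0f m : fld G0 (e m) by exists (e (pickle (m, m))); exists m, m.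
have G0good : good G0.
  split; [|split].
  - move=> _ _ [m [n ->]] [m' [n' ->]] /=; split=> [[/ei -> /ei ->] //|].
    by move=> /ei /(pcan_inj pickleK) [-> ->].
  - by move=> _ _ _ [m [n [-> -> ->]]]; split; exact: G0f.
  - move=> _ _ [? [m [? [-> _ _]]]] [? [n [? [-> _ _]]]].
    by exists (e (pickle (m, n))); exists m, n.
(* Adjoining the countable pairing [G0] keeps every field infinite and lets the empty chain have a
   valid union. *)
pose P (G : set (A * A * A)) := good (G `|` G0)%classic.
have [F FP Ftot|G [[Hf [Hd Ht]] Gmax]] := @Zorn_bigcup _ P.
  set U := (\bigcup_(X in F) X)%classic.
  (* Goodness involves at most two triples at a time, so it passes to the union once both lie in one
     member of the chain, or in [G0]. *)
  have pick p q : (U `|` G0)%classic p -> (U `|` G0)%classic q ->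
      exists X, [/\ P X, (X `<=` U)%classic, (X `|` G0)%classic p & (X `|` G0)%classic q].
    move=> [[X FX Xp]|Gp] [[Y FY Yq]|Gq].
    - have [XY|YX] := Ftot _ _ FX FY.
        exists Y; split; [exact: FP| by move=> x; exists Y| by left; exact: XY|by left].
      exists X; split; [exact: FP| by move=> x; exists X|by left| by left; exact: YX].
    - by exists X; split; [exact: FP|move=> x; exists X|left|right].
    - by exists Y; split; [exact: FP|move=> x; exists Y|right|left].
    - by exists classical_sets.set0; split=> //; [rewrite /P classical_sets.set0U|right|right].
  have sub X p : (X `<=` U)%classic -> (X `|` G0)%classic p -> (U `|` G0)%classic p.
    by move=> XU [/XU|]; [left|right].
  split; [|split].
  - by move=> p q /pick h /h [X [[XP _] _ Xp Xq]]; exact: XP.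
  - move=> a b c Up; have [X [[_ [XP _]] XU Xp _]] := pick _ _ Up Up.
    by have [[x ?] [y ?] [z ?]] := XP _ _ _ Xp; split;
      [exists x|exists y|exists z]; apply: sub XU _.
  - move=> a b [x /pick h] [y /h [X [[_ [_ XP]] XU Xx Xy]]].
    have [||c Xc] := XP a b; [by exists x|by exists y|].
    by exists c; exact: sub XU _.
set H := (G `|` G0)%classic in Hf Hd Ht.
pose S := {a | fld H a}.
have SS : card_le (S * S)%type S.
  have /choice[f fP] : forall p : S * S, exists c : S, H (sval p.1, sval p.2, sval c).
    move=> [[a Ha] [b Hb]]; have [c Hc] := Ht _ _ Ha Hb.
    by have [_ _ Hc'] := Hd _ _ _ Hc; exists (exist _ c Hc').
  exists f => p q epq; have := fP p; rewrite epq => /(Hf _ _ (fP q)) /= [_ /(_ erefl)].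
  by case: p q {epq} => a b [a' b'] /= [/sig_inj -> /sig_inj ->].
have He m : fld H (e m) by have [c Hc] := G0f m; exists c; right.
pose s m : S := exist _ _ (He m).
have SpS : card_le (S + S)%type S.
  apply: (card_le_trans _ SS).
  exists (fun x => match x with inl a => (s 0, a) | inr a => (s 1, a) end).
  by move=> [a|a] [b|b] // [] => [->|/ei|/ei|->].
have SA : card_le S A := card_le_sig _.
have [SC|CS] := card_le_total S {a | ~ fld H a}; last first.
  have AS : card_le A S.
    apply: (card_le_trans _ (card_le_trans (card_le_sum (card_le_refl S) CS) SpS)).
    exists (fun a => match pselect (fld H a) with
                     | left h => inl (exist _ a h) | right h => inr (exist _ a h) end).
    by move=> a b; case: pselect => ha; case: pselect => hb // [].
  exact: card_le_trans (card_le_prod AS AS) (card_le_trans SS SA).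
have [g gi] := SC.
pose S' := {a | fld H a \/ exists x, a = sval (g x)}.
have S'S : card_le S' S.
  apply: (card_le_trans _ SpS).
  have /choice[f fP] : forall a : S', exists x : S + S,
      match x with inl y => sval y = sval a | inr y => sval (g y) = sval a end.
    by move=> [a [Ha|[x ax]]]; [exists (inl (exist _ a Ha))|exists (inr x)].
  exists f => a b eab; apply: sig_inj.
  by have := fP a; have := fP b; rewrite eab; case: (f b) => y -> ->.
have [k ki] : card_le (S' * S')%type S := card_le_trans (card_le_prod S'S S'S) SS.
(* Pairs of [S'] that are not in [S * S] get values in the range of [g]. These lie outside [S], so
   they never collide with old values. *)
pose new : set (A * A * A) := fun p => exists x y : S',
  [/\ p.1 = (sval x, sval y), ~ (fld H (sval x) /\ fld H (sval y)) & p.2 = sval (g (k (x, y)))].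
pose H' := (H `|` new)%classic.
have ngf x : ~ fld H (sval (g x)) by case: (g x).
have H'S a : fld H' a <-> fld H a \/ exists x, a = sval (g x).
  split=> [[c [Hc|[x [y [/= [ex ey] _ _]]]]]|[[c Hc]|[x ax]]].
  - by left; exists c.
  - by rewrite ex; exact: svalP x.
  - by exists c; left.
  - have h : fld H a \/ exists x, a = sval (g x) by right; exists x.
    exists (sval (g (k (exist _ a h, exist _ a h)))); right; exists (exist _ a h), (exist _ a h).
    by split=> //= -[]; rewrite ax => /ngf.
have HG0 : (H' `|` G0)%classic = H'.
  by apply/seteqP; split=> p; [move=> [//|?]; left; right|left].
case: (Gmax H').
  split; first by move=> p Gp; left; left.
  pose a := g (s 0); have /H'S[c ac] : fld H (sval a) \/ exists x, sval a = sval (g x).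
    by right; exists (s 0).
  move=> sub; apply: (ngf (s 0)); exists c; left; exact: sub.
rewrite /P HG0; split; [|split].
- have cross p q : H p -> new q -> (p.1 = q.1 <-> p.2 = q.2).
    case: p q => -[a b] c [[a' b'] c'] Hp [x [y /= [[-> ->] nf ->]]].
    have [fa fb fc] := Hd _ _ _ Hp; split=> [[ea eb]|ec].
      by case: nf; rewrite -ea -eb.
    by case: (ngf (k (x, y))); rewrite -ec.
  move=> p q [Hp|Np] [Hq|Nq]; [exact: Hf|exact: cross| |].
  + by split=> /esym /(cross _ _ Hq Np) ->.
  + case: p q Np Nq => -[a b] c [[a' b'] c'] [x [y [/= [-> ->] _ ->]]] [x' [y' [/= [-> ->] _ ->]]].
    split=> [[/sig_inj -> /sig_inj -> //]|].
    by move=> /sig_inj /gi /ki [-> ->].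
- move=> a b c [Hp|[x [y [/= [-> ->] _ ->]]]].
    by have [? ? ?] := Hd _ _ _ Hp; split; apply/H'S; left.
  by split; apply/H'S; [exact: svalP x|exact: svalP y|right; eexists].
- move=> a b /H'S Sa /H'S Sb.
  case: (pselect (fld H a /\ fld H b)) => [[/Ht h /h [c Hc]]|nf]; first by exists c; left.
  by eexists; right; exists (exist _ a Sa), (exist _ b Sb); split=> //=.
Qed.
End Hessenberg.

Lemma card_le_addl A B C : card_le nat C -> card_le A C -> card_le B C -> card_le (A + B)%type C.
Proof.
move=> nC leA leB; apply: (card_le_trans (card_le_sum leA leB)).
apply: card_le_trans (card_le_square nC); have [e ei] := nC.
exists (fun x => match x with inl a => (e 0, a) | inr a => (e 1, a) end).
by move=> [a|a] [b|b] // [] => [->|/ei|/ei|->].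
Qed.

Lemma card_le_mull A B C : card_le nat C -> card_le A C -> card_le B C -> card_le (A * B)%type C.
Proof.
by move=> nC leA leB; exact: card_le_trans (card_le_prod leA leB) (card_le_square nC).
Qed.

Lemma card_le_tagged A (P : A -> Type) C : card_le nat C -> card_le A C ->
  (forall a, card_le (P a) C) -> card_le {a & P a} C.
Proof.
move=> nC leA leP; apply: card_le_trans (card_le_mull nC leA (card_le_refl C)).
exists (fun x => (tag x, sval (cid (leP (tag x))) (tagged x))).
move=> [a x] [b y] /= [eab]; subst b.
by move=> /(svalP (cid (leP a))) ->.
Qed.

Lemma card_le_option A C : card_le nat C -> card_le A C -> card_le (option A) C.
Proof.
move=> nC leA; have nU : card_le unit C.
  by apply: card_le_trans nC; exists (fun=> 0) => -[] [].
apply: card_le_trans (card_le_addl nC nU leA).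
by exists (fun x => if x is Some a then inr a else inl tt) => -[a|] [b|] // [->].
Qed.

Lemma card_le_bool C : card_le nat C -> card_le bool C.
Proof. by apply: card_le_trans; exists nat_of_bool => -[] []. Qed.

Lemma card_le_fin n C : card_le nat C -> card_le 'I_n C.
Proof. by apply: card_le_trans; exists (@nat_of_ord n); exact: val_inj. Qed.

Lemma card_le_seq A C : card_le nat C -> card_le A C -> card_le (seq A) C.
Proof.
move=> nC leA; have [f fi] := card_le_option nC (card_le_mull nC leA (card_le_refl C)).
pose code := fix code (s : seq A) := if s is x :: s' then f (Some (x, code s')) else f None.
exists code; elim=> [|x s IH] [|y s'] //= /fi //.
by move=> [-> /IH ->].
Qed.

Lemma card_le_finfun n A C : card_le nat C -> card_le A C -> card_le ('I_n -> A) C.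
Proof.
move=> nC leA; apply: card_le_trans (card_le_seq nC leA).
exists (fun h => [seq h i | i <- enum 'I_n]) => h h' e; apply/funext => i.
by move/eq_in_map: e; apply; rewrite mem_enum.
Qed.

Lemma card_le_cantor V C : card_le nat C -> card_le V (V -> C).
Proof.
move=> [e ei]; exists (fun v w => e `[< v = w >]) => v w /(congr1 (@^~ w)) /ei.
by rewrite (asboolT erefl); case: asboolP.
Qed.

Lemma card_le_const V C : V -> card_le C (V -> C).
Proof. by move=> v; exists (fun c _ => c) => c d /(congr1 (@^~ v)). Qed.

Lemma infinite_or_finite V : card_le nat V \/ exists n, card_le V 'I_n.
Proof.
have [|[f fi]] := card_le_total nat V; first by left.
case: (pselect (exists n, forall v, f v < n)) => [[n fn]|/forallNP unb].
  by right; exists n, (fun v => Ordinal (fn v)) => v w [/fi].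
have /choice[next nextP] : forall n, exists v, n <= f v.
  by move=> n; have /existsNP[v /negP] := unb n; rewrite -leqNgt; exists v.
(* Each point is chosen with an [f]-value above that of its predecessor, which makes [g]
   injective. *)
left; pose g n := iter n (fun v => next (f v).+1) (next 0).
have mono m n : m < n -> f (g m) < f (g n).
  elim: n => // n IH; rewrite ltnS leq_eqVlt => /orP[/eqP ->|/IH]; first exact: nextP.
  by move=> /ltn_trans; apply; exact: nextP.
exists g => m n egmn; case: (ltngtP m n) => // /mono; by rewrite egmn ltnn.
Qed.

(** For infinite [V] this is currying along an injection of [V * V] into [V]. For finite [V], a
    power of an infinite set with exponent [V] is no larger than the set, and this is applied
    twice. *)
Lemma card_le_power_power V C : card_le nat C -> V -> card_le (V -> V -> C) (V -> C).
Proof.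
move=> nC v0; have [nV|[n Vn]] := infinite_or_finite V.
  have [f fi] := card_le_square nV.
  have [g fg] : exists g : V -> V * V, forall p, g (f p) = p.
    suff /choice[g gP] : forall v, exists p : V * V, forall q, f q = v -> p = q.
      by exists g => p; exact: gP.
    move=> v; case: (pselect (exists q, f q = v)) => [[q <-]|nq].
      by exists q => r /fi.
    by exists (v0, v0) => q fq; case: nq; exists q.
  exists (fun h v => h (g v).1 (g v).2) => h h' e; apply/funext => a; apply/funext => b.
  by have := congr1 (@^~ (f (a, b))) e; rewrite /= fg.
have fin D : card_le nat D -> card_le D C -> card_le (V -> D) C.
  move=> nD DC; apply: card_le_trans (card_le_finfun n nC DC).
  have [f fi] := Vn.
  have [g fg] : exists g : 'I_n -> V, forall p, g (f p) = p.
    suff /choice[g gP] : forall v, exists p : V, forall q, f q = v -> p = q.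
      by exists g => p; exact: gP.
    move=> v; case: (pselect (exists q, f q = v)) => [[q <-]|nq].
      by exists q => r /fi.
    by exists v0 => q fq; case: nq; exists q.
  exists (fun h i => h (g i)) => h h' e; apply/funext => v.
  by have := congr1 (@^~ (f v)) e; rewrite /= fg.
have VC := fin _ nC (card_le_refl C).
apply: card_le_trans (card_le_const C v0).
by apply: fin VC; exact: card_le_trans nC (card_le_const C v0).
Qed.

Lemma card_le_fun V X Y : card_le (V -> X) X -> card_le Y X -> card_le (V -> Y) X.
Proof. by move=> leVX leY; exact: card_le_trans (card_le_arrow V leY) leVX. Qed.

Lemma card_le_fun_dom V X : card_le nat X -> card_le (V -> X) X -> card_le V X.
Proof. by move=> nX; exact: card_le_trans (card_le_cantor V nX). Qed.

(** The finitely many values over each [k] are bundled into one sequence, which is again coded by an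
    element of [X]. *)
Lemma card_le_fun_tagged (kappa : Type) (n : kappa -> nat) X : card_le nat X ->
  card_le (kappa -> X) X -> card_le ({k & 'I_(n k)} -> X) X.
Proof.
move=> nX leX; apply: card_le_trans leX.
apply: card_le_trans (card_le_arrow kappa (card_le_seq nX (card_le_refl X))).
exists (fun (h : {k & 'I_(n k)} -> X) k => [seq h (existT _ k m) | m <- enum 'I_(n k)]) => h h' e.
apply/funext => -[k m]; have /eq_in_map ek := congr1 (@^~ k) e.
by apply: ek; rewrite mem_enum.
Qed.

(** The bound on the size of [S] is witnessed by a function on all of [I], which avoids subtypes.
    Its negation expresses that [S] has more than [X] elements. *)
Definition small (X I : Type) (S : I -> Prop) :=
  exists e : I -> X, forall i j, S i -> S j -> e i = e j -> i = j.

Lemma small_sub X I (S S' : I -> Prop) : (forall i, S i -> S' i) -> small X S' -> small X S.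
Proof. by move=> sub [e ei]; exists e => i j /sub Si /sub; exact: ei. Qed.

Lemma small_card_le X I J (S : I -> Prop) (h : {i | S i} -> J) :
  X -> injective h -> card_le J X -> small X S.
Proof.
move=> x0 hi [e ei].
exists (fun i => match pselect (S i) with left s => e (h (exist _ i s)) | right _ => x0 end).
by move=> i j Si Sj; case: pselect => // si; case: pselect => // sj /ei /hi [].
Qed.

Lemma small_image X I J (f : J -> I) : X -> card_le J X -> small X (fun i => exists j, f j = i).
Proof.
move=> x0 JX; have /choice[h hP] : forall i : {i | exists j, f j = i}, exists j, f j = sval i.
  by case.
by apply: (@small_card_le X _ J _ h) => // i j e; apply: sig_inj; rewrite -!hP e.
Qed.

Lemma small_setU X I (S S' : I -> Prop) : card_le nat X ->
  small X S -> small X S' -> small X (fun i => S i \/ S' i).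
Proof.
move=> nX [e ei] [e' ei']; have [f fi] := card_le_addl nX (card_le_refl X) (card_le_refl X).
exists (fun i => f (if `[< S i >] then inl (e i) else inr (e' i))) => i j.
case: asboolP => Si; case: asboolP => Sj Ui Uj /fi // [].
  exact: ei.
by apply: ei'; [case: Ui|case: Uj].
Qed.

Lemma pigeonhole X I Y (S : I -> Prop) (f : I -> Y) : card_le nat X -> card_le Y X ->
  ~ small X S -> exists y, ~ small X (fun i => S i /\ f i = y).
Proof.
move=> nX YX; apply: contra_notP => /forallNP h.
have /choice[e ei] := fun y => contrapT (h y).
have [g gi] := card_le_mull nX YX (card_le_refl X).
exists (fun i => g (f i, e (f i) i)) => i j Si Sj /gi [fij].
by rewrite fij; apply: ei.
Qed.

Lemma not_small_two X I (S : I -> Prop) : X -> ~ small X S -> exists i j, [/\ S i, S j & i <> j].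
Proof.
move=> x; apply: contra_notP => h; exists (fun=> x) => i j Si Sj _.
by apply: contrapT => ij; apply: h; exists i, j.
Qed.

(** * Well-orders and Cantor's theorem *)

Lemma exists_well_order T : exists R : T -> T -> Prop, well_order R.
Proof.
elim/Peq: T => T; have [R Rwo] := wochoice.well_ordering_principle T.
have anti := wochoice.wo_chain_antisymmetric (wochoice.withinW Rwo).
have min (P : T -> Prop) : (exists x, P x) -> exists x, P x /\ forall y, P y -> R x y.
  move=> [x Px]; have [|z [[zP zm] _]] := Rwo [pred x | `[< P x >]].
    by exists x; apply/asboolP.
  by exists z; split=> [|y Py]; [exact/asboolP|apply: zm; exact/asboolP].
have tot x y : R x y \/ R y x.
  have [|z [[->|->] zm]] := min (fun z => z = x \/ z = y); first by exists x; left.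
    by left; apply: zm; right.
  by right; apply: zm; left.
have Ranti x y : R x y -> R y x -> x = y.
  by move=> xy yx; apply: anti => //; rewrite xy.
(* The well-ordering principle supplies a reflexive relation, of which this is the strict part.
   Transitivity comes from the minimum of the three points. *)
exists (fun x y => x <> y /\ R x y); split; [split; [|split]|].
- by move=> i [].
- move=> x y z [nxy xy] [nyz yz]; have [w [[|[|]] -> m]] :=
    min (fun w => w = x \/ w = y \/ w = z) (ex_intro _ x (or_introl erefl)).
  + split; last by apply: m; right; right.
    by move=> exz; apply: nxy; apply: Ranti => //; rewrite exz.
  + by case: nxy; apply: Ranti => //; apply: m; left.
  + by case: nyz; apply: Ranti => //; apply: m; right; left.
- move=> x y; case: (pselect (x = y)) => [|nxy]; first by right; left.
  by have [xy|yx] := tot x y; [left|right; right; split=> // /esym].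
- move=> x; apply: contrapT => nx.
  have [y [ny ym]] := min (fun y => ~ Acc (fun x y => x <> y /\ R x y) y) (ex_intro _ x nx).
  apply: ny; constructor=> z [nzy zy]; apply: contrapT => nz.
  by apply: nzy; apply: Ranti => //; exact: ym.
Qed.

Lemma well_order_min T (R : T -> T -> Prop) (P : T -> Prop) : well_order R ->
  (exists x, P x) -> exists x, P x /\ forall y, P y -> ~ R y x.
Proof.
move=> [_ Rwf] [x]; elim/(well_founded_induction Rwf): x => x IH Px.
case: (pselect (exists y, P y /\ R y x)) => [[y [Py yx]]|h]; first exact: IH yx Py.
by exists x; split=> // y Py yx; apply: h; exists y.
Qed.

Lemma cantor_not_card_le A : ~ card_le (A -> bool) A.
Proof.
move=> [f fi]; pose g a := `[< exists h, f h = a /\ ~~ h a >].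
case gE: (g (f g)).
  by have /asboolP[h [/fi -> ]] := gE; rewrite gE.
by have /asboolP[] := negbT gE; exists g; rewrite gE.
Qed.

(** * Linear orders with a small dense subset *)

Lemma small_card_le_sig X I (S : I -> Prop) : small X S -> card_le {i | S i} X.
Proof.
by move=> [e ei]; exists (fun i => e (sval i)) => i j /ei eij; apply: sig_inj;
  apply: eij; exact: svalP.
Qed.

Lemma small_sig X I (S P : I -> Prop) : X ->
  small X (fun j : {i | S i} => P (sval j)) -> small X (fun i => S i /\ P i).
Proof.
move=> x [e ei].
exists (fun i => match pselect (S i) with left s => e (exist _ i s) | right _ => x end).
move=> i j [Si Pi] [Sj Pj]; case: pselect => // si; case: pselect => // sj /ei.
by move=> /(_ Pi Pj) [].
Qed.

Section Lex.
Variables (X : Type) (R : X -> X -> Prop).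
Hypothesis Rwo : well_order R.
Implicit Types f g : X -> bool.

Definition lexb f g := exists y, [/\ f y = false, g y = true & forall z, R z y -> f z = g z].

Lemma lexb_strict_total : strict_total lexb.
Proof.
have [[Rirr [Rtr Rtot]] _] := Rwo; split; [|split].
- by move=> f [y [-> ]].
- move=> f g h [y [fy gy fg]] [z [gz hz gh]].
  have [yz|[yz|zy]] := Rtot y z.
  + exists y; split=> // [|w wy]; first by rewrite -gh.
    by rewrite fg // gh //; exact: Rtr wy yz.
  + by subst z; rewrite gz in gy.
  + exists z; split=> // [|w wz]; first by rewrite fg.
    by rewrite fg ?gh //; exact: Rtr wz zy.
- move=> f g; case: (pselect (exists y, f y <> g y)) => [/(well_order_min Rwo)[y [ny ym]]|ne].
  + have eq z : R z y -> f z = g z.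
      by move=> zy; apply: contrapT => /ym /(_ zy).
    case fy: (f y); case gy: (g y); rewrite ?fy ?gy // in ny *.
      by right; right; exists y; split=> // z /eq.
    by left; exists y; split=> // z /eq.
  + by right; left; apply/funext => y; apply: contrapT => h; apply: ne; exists y.
Qed.
End Lex.

(* For [N] an initial segment of a well-order of [X] that is minimal with
   [2^N] not embeddable in [X], the eventually vanishing functions form a dense
   subset of [2^N] of size at most [X]. *)
Lemma exists_order_with_small_dense_subset (X Y : Type) :
  card_le nat X -> card_le X Y -> ~ card_le Y X ->
  exists (J : Type) (Q : J -> J -> Prop) (J0 : J -> Prop),
    [/\ strict_total Q, card_le J Y, ~ small X (fun j => ~ J0 j), card_le {j | J0 j} X &
     forall i j, ~ J0 i -> ~ J0 j -> Q i j -> exists b, [/\ J0 b, Q i b & Q b j]].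
Proof.
move=> nX leXY nYX; have [e0 _] := nX; pose x0 := e0 0.
have [R Rwo] := exists_well_order X; have [[Rirr [Rtr Rtot]] _] := Rwo.
(* [N] is the least initial segment carrying more than [X] subsets; if no proper one does, it is all
   of [X], by Cantor's theorem. *)
have [N [Nbig Nseg]] : exists N : X -> Prop,
    ~ small X (fun f : X -> bool => forall y, f y -> N y) /\
    forall y, N y -> small X (fun f : X -> bool => forall z, f z -> R z y).
  pose P x := ~ small X (fun f : X -> bool => forall y, f y -> R y x).
  case: (pselect (exists x, P x)) => [/(well_order_min Rwo)[x [Px xm]]|nP].
    exists (R ^~ x); split=> // y yx; apply: contrapT => /xm; exact.
  exists (fun=> True); split=> [[e ei]|y _]; last by apply: contrapT => h; apply: nP; exists y.
  by apply: (@cantor_not_card_le X); exists e => f g; exact: ei.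
pose B (f : X -> bool) := forall y, f y -> N y.
pose J0 (f : X -> bool) := exists y, N y /\ forall z, f z -> R z y \/ z = y.
have J0small : small X J0.
  have /choice[e eP] : forall y, exists e : (X -> bool) -> X, N y ->
      forall f g : X -> bool, (forall z, f z -> R z y) -> (forall z, g z -> R z y) ->
      e f = e g -> f = g.
    move=> y; case: (pselect (N y)) => [/Nseg[e ei]|nN]; first by exists e.
    by exists (fun=> x0).
  have [h hi] :=
    card_le_mull nX (card_le_refl X) (card_le_mull nX (card_le_bool nX) (card_le_refl X)).
  have /choice[y yP] : forall f, exists y, J0 f -> N y /\ forall z, f z -> R z y \/ z = y.
    by move=> f; case: (pselect (J0 f)) => [[y]|]; [exists y|exists x0].
  pose cut (f : X -> bool) x z := f z && `[< R z x >].
  (* A function vanishing beyond [y] is determined by [y], its value there and its part below [y].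
     Minimality of [N] leaves at most [X] such parts. *)
  exists (fun f => h (y f, (f (y f), e (y f) (cut f (y f))))) => f g.
  move=> /yP [Nf fy] /yP [Ng gy] /hi [ey]; rewrite -ey in gy * => eyy.
  have cutR k z : cut k (y f) z -> R z (y f) by move=> /andP[_ /asboolP].
  move=> /(eP _ Nf _ _ (cutR f) (cutR g)) ecut; apply/funext => z.
  have ez : cut f (y f) z = cut g (y f) z by rewrite ecut.
  have [zy|[->//|yz]] := Rtot z (y f).
    by move: ez; rewrite /cut asboolT // !andbT.
  have nz (k : X -> bool) : (forall z, k z -> R z (y f) \/ z = y f) -> k z = false.
    move=> kP; apply/negP => /kP [zy|zy]; first by apply: (Rirr z); exact: Rtr zy yz.
    by rewrite zy in yz; exact: Rirr yz.
  by rewrite !nz.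
(* There may be more than [Y] functions supported on [N]; in that case a copy of [Y] among them is
   kept. *)
have [J1 [J1B J1Y J1big]] : exists J1 : (X -> bool) -> Prop,
    [/\ forall f, J1 f -> B f, card_le {f | J1 f} Y & ~ small X J1].
  have [[e ei]|BY] := card_le_total Y {f | B f}; last by exists B.
  exists (fun f => exists a, sval (e a) = f); split=> [f [a <-]| |[h hi]].
  - exact: svalP (e a).
  - apply: (@card_le_surj _ _ (fun a => exist _ (sval (e a)) (ex_intro _ a erefl))).
    by move=> [f [a fa]]; exists a; apply: sig_inj.
  - apply: nYX; exists (h \o (fun a => sval (e a))) => a b /hi /= eab.
    by apply: ei; apply: sig_inj; apply: eab; eexists.
pose J := {f | J0 f \/ J1 f}.
have nY := card_le_trans nX leXY.
exists J, (fun i j => lexb R (sval i) (sval j)), (fun j => J0 (sval j)); split.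
- have [irr [tr tot]] := lexb_strict_total Rwo; split; [|split] => [i|i j k|i j].
  + exact: irr.
  + exact: tr.
  + by have [|[/sig_inj|]] := tot (sval i) (sval j); [left|right; left|right; right].
- apply: card_le_trans (card_le_addl nY (card_le_trans (small_card_le_sig J0small) leXY) J1Y).
  exists (fun j : J => match pselect (J0 (sval j)) with
     | left h => inl (exist _ _ h)
     | right h => inr (exist _ (sval j) (match svalP j with
                        | or_introl h' => match h h' with end
                        | or_intror h' => h' end)) end).
  by move=> i j; case: pselect => hi; case: pselect => hj // [] /sig_inj.
- move=> h0; have h := @small_sig _ _ (fun f => J0 f \/ J1 f) (fun f => ~ J0 f) x0 h0; apply: J1big.
  apply: (small_sub _ (small_setU nX J0small h)) => f J1f.
  by case: (pselect (J0 f)) => nf; [left|right; split=> //; right].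
- apply: card_le_trans (small_card_le_sig J0small).
  exists (fun j : {j : J | J0 (sval j)} => exist J0 (sval (sval j)) (svalP j)).
  by move=> i j [/sig_inj /sig_inj].
- move=> [f Jf] [g Jg] /= nf ng [y [fy gy fg]].
  have Ny : N y by case: Jg => [/ng|/J1B] //; exact.
  (* [b] is [g] cut off after [y], the first place where [f] and [g] differ. It exceeds [f] at [y],
     lies pointwise below [g], and differs from [g] because [g] is not in [J0]. *)
  pose b z := g z && (`[< R z y >] || `[< z = y >]).
  have J0b : J0 b.
    by exists y; split=> // z /andP[_ /orP[/asboolP|/asboolP]]; [left|right].
  exists (exist _ b (or_introl J0b)); split=> //=.
    exists y; split=> // [|z zy]; first by rewrite /b gy (asboolT erefl) orbT.
    by rewrite /b (asboolT zy) andbT fg.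
  have [irr [_ tot]] := lexb_strict_total Rwo.
  have [//|[bg|[z [gz bz _]]]] := tot b g; first by case: ng; rewrite -bg.
  by move: bz; rewrite /b gz.
Qed.

(** * Galois types in EM models *)

Section Terms.
Variable t : vocab.

Fixpoint tmap (V W : Type) (h : V -> W) (u : term t V) : term t W :=
  match u with
  | tvar x => tvar t (h x)
  | tapp f a => tapp (fun i => tmap h (a i))
  end.

Lemma teval_tmap (V W : Type) (h : V -> W) (N : Str t) (v : W -> N) (u : term t V) :
  teval v (tmap h u) = teval (fun x => v (h x)) u.
Proof. by elim: u => //= f a IH; congr fint; apply/funext. Qed.

Lemma eq_teval (V : Type) (N : Str t) (v v' : V -> N) (u : term t V) :
  (forall x, v x = v' x) -> teval v u = teval v' u.
Proof. by move=> /funext ->. Qed.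

Lemma emb_teval (V : Type) (M N : Str t) (g : M -> N) (v : V -> M) (u : term t V) :
  emb g -> g (teval v u) = teval (fun x => g (v x)) u.
Proof.
by move=> [_ [gf _]]; elim: u => //= f a IH; rewrite gf; congr fint; apply/funext.
Qed.

Lemma card_le_term V C : card_le nat C -> card_le V C -> card_le (symbols t) C ->
  card_le (term t V) C.
Proof.
move=> nC leV leS.
have [e ei] := card_le_addl nC leV (card_le_mull nC leS (card_le_seq nC (card_le_refl C))).
pose code := fix code (u : term t V) : C :=
  match u with
  | tvar x => e (inl x)
  | tapp f a => e (inr (inl f, [seq code (a i) | i <- enum 'I_(farity f)]))
  end.
exists code; elim=> [x|f a IH] [y|g b] //= /ei // []; first by move->.
move=> fg; subst g => /eq_in_map eab; congr tapp; apply/funext => i.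
by apply: IH; apply: eab; rewrite mem_enum.
Qed.

End Terms.

(** * Galois types and strong embeddings *)

Section GaloisTypes.
Variables (t : vocab) (K : Str t -> Prop) (leK : forall N : Str t, (N -> Prop) -> Prop).
Variables (Aty X : Type).
Implicit Types p q r : triple t Aty X.

Lemma gtp_eq_trans q p r : gtp_eq K leK p q -> gtp_eq K leK q r -> gtp_eq K leK p r.
Proof. exact: Relation_Operators.rt_trans. Qed.

Lemma gtp_eq_sym p q : gtp_eq K leK p q -> gtp_eq K leK q p.
Proof.
elim=> [x y [Kx [Ky [ix [iy [N [f [g [KN [kf [kg [ea eb]]]]]]]]]]]|x|x y z _ yx _ zy].
- apply: Relation_Operators.rt_step; do 4!split=> //.
  by exists N, g, f; do 3!split=> //; split=> ?; rewrite ?ea ?eb.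
- exact: Relation_Operators.rt_refl.
- exact: gtp_eq_trans zy yx.
Qed.

(** [N'] itself amalgamates the two triples, by [h] on one side and the identity on the other. *)
Lemma gtp_eq_kemb (N N' : Str t) (h : N -> N') (a : Aty -> N) (b : X -> N) :
  is_AEC K leK -> K N -> K N' -> kemb leK h -> injective a ->
  gtp_eq K leK (Triple a b) (Triple (fun x => h (a x)) (fun x => h (b x))).
Proof.
move=> [_ [_ [Krefl _]]] KN KN' kh ai; apply: Relation_Operators.rt_step.
do 3!split=> //=; split; first exact: inj_comp (proj1 (proj1 kh)) ai.
exists N', h, id; do 2!split=> //; split=> //; split; first by split.
have -> : (fun y : N' => exists x, id x = y) = (fun=> True); last exact: Krefl.
by apply/funext => y; apply/propext; split=> // _; exists y.
Qed.

End GaloisTypes.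

(** * Elements of EM models as terms over the index order *)

Section EMModels.
Variables (t : vocab) (K : Str t -> Prop) (leK : forall N : Str t, (N -> Prop) -> Prop).
Variables (chi : Type) (Phi : blueprint t).
Variables (EMs : forall I : Type, (I -> I -> Prop) -> Str (tauPhi Phi))
          (EMi : forall (I : Type) (R : I -> I -> Prop), I -> EMs R).
Hypothesis EMf : EM_family K leK chi EMi.

Lemma EM_term (I : Type) (R : I -> I -> Prop) (x : EMs R) : strict_total R ->
  exists (p : {n & term (tauPhi Phi) 'I_n}) (w : 'I_(tag p) -> I),
    x = teval (fun m => EMi R (w m)) (tagged p).
Proof.
move=> Rst; have [_ [gen _]] := proj1 EMf I R Rst.
move: x; apply: gen => [f x IH|i]; last first.
  by exists (existT _ 1 (tvar _ ord0)), (fun=> i).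
have [p pP] := choice IH.
pose w i := sval (cid (pP i)); have wP i : x i = _ := svalP (cid (pP i)).
(* The arguments get disjoint sets of variables, and [h] renumbers their union [F] by an ordinal. *)
pose F := {i : 'I_(farity f) & 'I_(tag (p i))}.
pose h i (m : 'I_(tag (p i))) : 'I_#|{: F}| := enum_rank (Tagged _ m : F).
exists (existT _ #|{: F}| (tapp (fun i => tmap (@h i) (tagged (p i))))).
exists (fun m => w (tag (enum_val m)) (tagged (enum_val m))) => /=.
congr fint; apply/funext => i; rewrite teval_tmap wP; apply: eq_teval => m.
by rewrite /h enum_rankK.
Qed.

Lemma EM_terms (P I : Type) (R : I -> I -> Prop) (x : P -> EMs R) : strict_total R ->
  exists (p : P -> {n & term (tauPhi Phi) 'I_n}) (w : {e & 'I_(tag (p e))} -> I),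
    forall e, x e = teval (fun m => EMi R (w (Tagged _ m))) (tagged (p e)).
Proof.
move=> Rst; have [p pP] := choice (fun e => EM_term (x e) Rst).
exists p, (fun em => sval (cid (pP (tag em))) (tagged em)) => e.
exact: svalP (cid (pP e)).
Qed.

(** Galois types of term values depend only on the order type of the tuple plugged in: the EM model
    over the range of [f] embeds strongly into both models, along the inclusion and along the map
    induced by [f']. *)
Lemma gtp_eq_EM (U Aty X I J : Type) (R : I -> I -> Prop) (Q : J -> J -> Prop)
    (f : U -> I) (f' : U -> J)
    (qa : Aty -> term (tauPhi Phi) U) (qb : X -> term (tauPhi Phi) U) :
  is_AEC K leK -> strict_total R -> strict_total Q ->
  (forall x y, R (f x) (f y) -> Q (f' x) (f' y)) ->
  (forall x y, f x = f y -> f' x = f' y) ->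
  injective (fun a => teval (fun x => EMi R (f x)) (qa a)) ->
  injective (fun a => teval (fun x => EMi Q (f' x)) (qa a)) /\
  gtp_eq K leK
    (@Triple t Aty X (reduct (EMs R)) (fun a => teval (fun x => EMi R (f x)) (qa a))
       (fun x => teval (fun x => EMi R (f x)) (qb x)))
    (@Triple t Aty X (reduct (EMs Q)) (fun a => teval (fun x => EMi Q (f' x)) (qa a))
       (fun x => teval (fun x => EMi Q (f' x)) (qb x))).
Proof.
move=> aec Rst Qst fR fE ainj.
pose I0 := {i | exists u, f u = i}; pose R0 (i j : I0) := R (sval i) (sval j).
have R0st : strict_total R0.
  have [irr [tr tot]] := Rst; split; [|split] => [i|i j k|i j].
  - exact: irr.
  - exact: tr.
  - by have [|[/sig_inj|]] := tot (sval i) (sval j); [left|right; left|right; right].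
pose f0 u : I0 := exist _ (f u) (ex_intro _ u erefl).
have /choice[s sP] : forall i : I0, exists u, f u = sval i by case.
have sf u : f' (s (f0 u)) = f' u by apply: fE; rewrite sP.
have [g [ge [gi gk]]] := proj2 EMf I0 I R0 R sval R0st Rst (fun i j h => h).
have [|g' [ge' [gi' gk']]] := proj2 EMf I0 J R0 Q (fun i => f' (s i)) R0st Qst.
  by move=> i j ij; apply: fR; rewrite !sP.
have ev u : g (teval (fun x => EMi R0 (f0 x)) u) = teval (fun x => EMi R (f x)) u.
  by rewrite (emb_teval _ _ ge); apply: eq_teval => x; rewrite gi.
have ev' u : g' (teval (fun x => EMi R0 (f0 x)) u) = teval (fun x => EMi Q (f' x)) u.
  by rewrite (emb_teval _ _ ge'); apply: eq_teval => x; rewrite gi' sf.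
have a0inj : injective (fun a => teval (fun x => EMi R0 (f0 x)) (qa a)).
  by move=> a b /(congr1 g); rewrite !ev; exact: ainj.
have KEM L (T : L -> L -> Prop) : strict_total T -> K (reduct (EMs T)).
  by move=> /(proj1 EMf L T) [_ [_ [_ []]]].
pose b0 x := teval (fun x => EMi R0 (f0 x)) (qb x).
have step L (T : L -> L -> Prop) (h : EMs R0 -> EMs T) Tst :=
  @gtp_eq_kemb t K leK Aty X (reduct (EMs R0)) (reduct (EMs T)) h _ b0
    aec (KEM _ _ R0st) (KEM _ T Tst) ^~ a0inj.
have s1 := step _ _ g Rst gk; have s2 := step _ _ g' Qst gk'.
rewrite (funext (fun a => ev (qa a))) (funext (fun x => ev (qb x))) in s1.
rewrite (funext (fun a => ev' (qa a))) (funext (fun x => ev' (qb x))) in s2.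
split; last exact: gtp_eq_trans (gtp_eq_sym s1) s2.
by move=> a b; rewrite -!ev' => /(proj1 ge') /a0inj.
Qed.
(** There are at most [X] families of terms indexed by [kappa], so more than [X] of the sequences
    [x i] share one family and differ only in the tuple [s i]. *)
Lemma EM_terms_pigeonhole (X kappa I W : Type) (R : W -> W -> Prop)
    (x : I -> kappa -> EMs R) (S : I -> Prop) :
  strict_total R -> card_le nat X ->
  card_le (symbols (tauPhi Phi)) X -> card_le (kappa -> X) X -> ~ small X S ->
  exists (p : kappa -> {n & term (tauPhi Phi) 'I_n}) (s : I -> {k & 'I_(tag (p k))} -> W),
    ~ small X (fun i => S i /\
       forall k, x i k = teval (fun m => EMi R (s i (Tagged _ m))) (tagged (p k))).
Proof.
move=> Rst nX leS leX Sbig.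
have /choice[p pP] := fun i => EM_terms (x i) Rst.
have leT : card_le (kappa -> {n & term (tauPhi Phi) 'I_n}) X.
  apply: (card_le_fun leX); apply: card_le_tagged => // n.
  exact: card_le_term nX (card_le_fin n nX) leS.
have [q qbig] := pigeonhole p nX leT Sbig.
have /choice[s sP] : forall i, exists s : {k & 'I_(tag (q k))} -> W, S i /\ p i = q ->
    forall k, x i k = teval (fun m => EMi R (s (Tagged _ m))) (tagged (q k)).
  move=> i; case: (pselect (p i = q)) => [<-|nq]; first by have [w wP] := pP i; exists w.
  (* An index using other terms gets a default tuple, borrowed from some [j] that uses [q]. *)
  have [j [_ [[_ jq] _ _]]] := not_small_two ((proj1_sig (cid nX)) 0) qbig.
  by rewrite -jq; have [w _] := pP j; exists w => -[_ ij]; case: nq; rewrite -jq.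
exists q, s; apply: contra_not qbig; apply: small_sub => i Si.
by split; [case: Si|exact: sP].
Qed.

End EMModels.

(** * Stretching a pair of tuples in a well-order *)

Section OrderConstructions.
Variables (A B : Type) (R : A -> A -> Prop) (Q : B -> B -> Prop).

Definition with_top (x y : option A) : Prop :=
  match x, y with
  | Some a, Some b => R a b
  | Some _, None => True
  | None, _ => False
  end.

Definition lexp (x y : A * B) : Prop := R x.1 y.1 \/ x.1 = y.1 /\ Q x.2 y.2.

Lemma with_top_strict_total : strict_total R -> strict_total with_top.
Proof.
move=> [irr [tr tot]]; split; [|split].
- by case.
- by move=> [a|] [b|] [c|] //; exact: tr.
- move=> [a|] [b|]; [|by left|by right; right|by right; left].
  by have [|[->|]] := tot a b; [left|right; left|right; right].
Qed.

Lemma with_top_well_order : well_order R -> well_order with_top.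
Proof.
move=> [Rst Rwf]; split; first exact: with_top_strict_total.
have accS a : Acc with_top (Some a).
  by elim/(well_founded_induction Rwf): a => a IH; constructor=> -[b /IH|[]].
case=> [a|]; first exact: accS.
by constructor=> -[b _|[]]; exact: accS.
Qed.

Lemma lexp_strict_total : strict_total R -> strict_total Q -> strict_total lexp.
Proof.
move=> [Ri [Rt Rc]] [Qi [Qt Qc]]; split; [|split].
- by move=> x [/Ri|[_ /Qi]].
- move=> x y z [xy|[exy xy]] [yz|[eyz yz]].
  + by left; exact: Rt xy yz.
  + by left; rewrite -eyz.
  + by left; rewrite exy.
  + by right; split; [rewrite exy|exact: Qt xy yz].
- move=> [a b] [a' b']; rewrite /lexp /=.
  have [|[->|]] := Rc a a'; [by left; left| |by right; right; left].
  have [|[->|]] := Qc b b'; [by left; right|by right; left|by right; right; right].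
Qed.
End OrderConstructions.

(** Between strict total orders these implications already reverse, so [f] and [g] have the same
    order type. *)
Definition order_hom (U A B : Type) (R : A -> A -> Prop) (Q : B -> B -> Prop)
    (f : U -> A) (g : U -> B) : Prop :=
  (forall x y, R (f x) (f y) -> Q (g x) (g y)) /\ (forall x y, f x = f y -> g x = g y).

Definition sumf (A B C : Type) (f : A -> C) (g : B -> C) (x : A + B) : C :=
  match x with inl a => f a | inr b => g b end.

Lemma asbool_iff (P Q : Prop) : `[< P >] = `[< Q >] -> (P <-> Q).
Proof.
by move=> e; split=> [/asboolT|/asboolT]; [rewrite e|rewrite -e] => /asboolW.
Qed.

(** * Order types of tuples over parameters in a well-order *)

Section Patterns.
Variables (W : Type) (R : W -> W -> Prop) (Rwo : well_order R).
Variables (X D V I : Type) (c : D -> W) (s : I -> V -> W).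
Hypotheses (nX : card_le nat X) (leD : card_le D X) (leVX : card_le (V -> X) X).

(* Since [W] is well-ordered, the cut of [w] over the range of [c] is coded by
   the least [c d] not below [w] and by whether [w] is equal to it. *)
Lemma order_type_pigeonhole (S : I -> Prop) : ~ small X S ->
  exists S' : I -> Prop, [/\ forall i, S' i -> S i, ~ small X S' &
    forall i j, S' i -> S' j -> order_hom R R (sumf (s i) c) (sumf (s j) c)].
Proof.
have [[Rirr [Rtr Rtot]] _] := Rwo.
have Rn x y : ~ R x y -> ~ R y x -> x = y by move=> h h'; have [|[]] := Rtot x y.
have /choice[cut cutP] : forall w, exists o : option D, if o is Some d
    then ~ R (c d) w /\ forall e, ~ R (c e) w -> ~ R (c e) (c d) else forall d, R (c d) w.
  move=> w; case: (pselect (exists d, ~ R (c d) w)) => [[d dw]|h]; last first.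
    by exists None => d; apply: contrapT => dw; apply: h; exists d.
  have [|x [[[e <-] ew] em]] := @well_order_min _ _ (fun x => (exists d, c d = x) /\ ~ R x w) Rwo.
    by exists (c d); split=> //; exists d.
  by exists (Some e); split=> // e' e'w; apply: em; split=> //; exists e'.
(* The code records the order pattern inside the tuple and the cut of each entry over the
   parameters. *)
pose code i := (fun v v' => `[< R (s i v) (s i v') >],
   fun v => (cut (s i v), if cut (s i v) is Some d then `[< R (s i v) (c d) >] else true)).
have leC : card_le ((V -> V -> bool) * (V -> option D * bool))%type X.
  apply: card_le_mull => //; apply: (card_le_fun leVX).
    exact: card_le_fun leVX (card_le_bool nX).
  exact: card_le_mull nX (card_le_option nX leD) (card_le_bool nX).
have cutE i j v d : code i = code j ->
    (R (s i v) (c d) -> R (s j v) (c d)) /\ (R (c d) (s i v) -> R (c d) (s j v)).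
  move=> [_ ecut]; have := congr1 (@^~ v) ecut => -[].
  have := cutP (s i v); have := cutP (s j v).
  case: (cut (s j v)) (cut (s i v)) => [e|] [e'|] // => [|cj ci _ _]; last first.
    by split=> [id|_]; [case: (Rirr (s i v)); exact: Rtr id (ci d)|exact: cj].
  move=> [cj mj] [ci mi] [ee]; subst e' => e_eq; have bE := asbool_iff e_eq.
  split.
    move=> id; have nde : ~ R (c d) (c e).
      by apply: mi => di; apply: (Rirr (s i v)); exact: Rtr id di.
    have [je|ej] := pselect (R (s j v) (c e)).
      by have [/(Rtr _ _ _ je)|[<-|]] := Rtot (c e) (c d).
    have <- : c e = s j v by exact: Rn.
    have [//|[ed|/nde //]] := Rtot (c e) (c d).
    by case: ej; apply/bE; rewrite ed.
  move=> di; have de : R (c d) (c e).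
    have [ie|[<-|ei]] := Rtot (s i v) (c e); [exact: Rtr di ie|exact: di|].
    by case: ci.
  by apply: contrapT => /mj.
move=> /(pigeonhole code nX leC) [y ny]; exists (fun i => S i /\ code i = y); split=> //.
  by move=> i [].
move=> i j [_ iy] [_ jy]; have ij : code i = code j by rewrite iy.
have [epat _] := ij.
have pat v v' : R (s i v) (s i v') <-> R (s j v) (s j v').
  by apply: asbool_iff; have := congr1 (fun f => f v v') epat.
have ce v d : s i v = c d -> s j v = c d.
  move=> e; have [h1 h2] := cutE _ _ v d (esym ij).
  by apply: Rn => [/h1|/h2]; rewrite e; exact: Rirr.
split=> -[v|d] [v'|d'] //=.
- by move=> /pat.
- by move=> /(proj1 (cutE _ _ _ _ ij)).
- by move=> /(proj2 (cutE _ _ _ _ ij)).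
- by move=> e; apply: Rn => /pat; rewrite e; exact: Rirr.
- exact: ce.
- by move=> /esym /ce.
Qed.
End Patterns.

(** Formal terms for operations of arity [V], possibly infinite. Closing a set under such operations
    is evaluating trees, so counting trees bounds the closure. *)
Inductive btree (L M V : Type) : Type :=
| Leaf of L
| Node of M & (V -> btree L M V).
Arguments Leaf {L M V}.
Arguments Node {L M V}.

Lemma card_le_btree L M V X : card_le nat X -> card_le L X -> card_le M X ->
  card_le (V -> X) X -> card_le (btree L M V) X.
Proof.
move=> nX leL leM leVX.
have [e ei] := card_le_addl nX leL (card_le_mull nX leM leVX).
pose code := fix code (T : btree L M V) : X :=
  match T with
  | Leaf l => e (inl l)
  | Node m b => e (inr (m, fun v => code (b v)))
  end.
exists code; elim=> [l|m b IH] [l'|m' b'] //= /ei // [-> // eb].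
by congr Node; apply/funext => v; apply: IH; exact: (congr1 (@^~ v) eb).
Qed.

Section Stretching.
Variables (W : Type) (R : W -> W -> Prop) (Rwo : well_order R).
Variables (I : Type) (RI : I -> I -> Prop) (RIwo : well_order RI).
Variables (X D V : Type) (c : D -> W) (s : I -> V -> W).
Hypotheses (nX : card_le nat X) (leD : card_le D X) (leVX : card_le (V -> X) X).
Variable S : I -> Prop.
Hypotheses (Sbig : ~ small X S)
  (Shom : forall i j, S i -> S j -> order_hom R R (sumf (s i) c) (sumf (s j) c)).

Let O := with_top R.
Let Owo : well_order O := with_top_well_order Rwo.

(** [m] marks the moving coordinates: there [s i v] lies in the gap just below [d v] left by the
    other values of [d]. Unmarked coordinates are pinned to [d v]. *)
Let ok (m : V -> bool) (d : V -> option W) (i : I) : Prop :=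
  S i /\ forall v, if m v
    then O (Some (s i v)) (d v) /\ forall v', O (d v') (d v) -> O (d v') (Some (s i v))
    else d v = Some (s i v).

(* [D'] is a set of at most [X] elements closed under solving the constraints
   [ok] with parameters in [D']: it consists of the values of the well-founded
   trees [btree]. For [i1] outside the set of chosen solutions, [d v] is the
   least element of [D'] that is not below [s i1 v], and [i0] is the chosen
   solution of the constraints with parameter [d]. *)
Lemma exists_reflected_pair : exists i0 i1 (d : V -> option W) (D' : option W -> Prop),
  [/\ S i0, S i1, RI i0 i1, forall x, D' (Some (c x)) & forall v, D' (d v)] /\
  [/\ forall v, D' (Some (s i0 v)), forall v, ~ O (d v) (Some (s i1 v)),
    forall x v, D' x -> O x (d v) -> O x (Some (s i1 v)),
    forall v, d v <> Some (s i1 v) -> O (Some (s i0 v)) (d v) /\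
       forall v', O (d v') (d v) -> O (d v') (Some (s i0 v)) &
    forall v, d v = Some (s i1 v) -> d v = Some (s i0 v)].
Proof.
have [Ost _] := Owo; have [Oirr [Otr Otot]] := Ost.
have [[_ [_ RItot]] _] := RIwo.
have [x0 _] := nX; have [i [_ [Si _ _]]] := not_small_two (x0 0) Sbig.
(* The chosen solution is [RI]-least, which later places [i0] before [i1]. *)
have /choice[pick pickP] : forall md : (V -> bool) * (V -> option W), exists i,
    (exists j, ok md.1 md.2 j) -> ok md.1 md.2 i /\ forall j, ok md.1 md.2 j -> ~ RI j i.
  move=> [m d]; case: (pselect (exists j, ok m d j)) => [|n]; last by exists i.
  by move=> /(well_order_min RIwo)[j jP]; exists j.
pose Tr := btree (option D) ((V -> bool) * V) V.
pose ev := fix ev (T : Tr) : option W :=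
  match T with
  | Leaf x => omap c x
  | Node mv b => Some (s (pick (mv.1, fun v => ev (b v))) mv.2)
  end.
have leVb : card_le (V -> bool) X := card_le_fun leVX (card_le_bool nX).
have leTr : card_le Tr X.
  apply: card_le_btree => //; first exact: card_le_option.
  exact: card_le_mull nX leVb (card_le_fun_dom nX leVX).
pose sol (p : (V -> bool) * (V -> Tr)) := pick (p.1, fun v => ev (p.2 v)).
have [i1 [Si1 ni1]] : exists i1, S i1 /\ ~ exists p, sol p = i1.
  apply: contrapT => h; apply: Sbig.
  have lep := card_le_mull nX leVb (card_le_fun leVX leTr).
  apply: (small_sub _ (small_image sol (x0 0) lep)).
  by move=> j Sj; apply: contrapT => nj; apply: h; exists j.
pose D' x := exists T, ev T = x.
(* The top element [None] is in [D'], so some element of [D'] is not below [s i1 v]. A tree for the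
   least one is kept, because [i1] must avoid solutions with parameters given by trees. *)
have /choice[b bP] : forall v, exists T, ~ O (ev T) (Some (s i1 v)) /\
    forall x, D' x -> ~ O x (Some (s i1 v)) -> ~ O x (ev T).
  move=> v; have [|x [[[T <-] nx] xm]] :=
    @well_order_min _ O (fun x => D' x /\ ~ O x (Some (s i1 v))) Owo.
    by exists None; split=> //; exists (Leaf None).
  by exists T; split=> // y Dy nys; apply: xm; split.
pose d v := ev (b v).
have dlow x v : D' x -> O x (d v) -> O x (Some (s i1 v)).
  by move=> Dx xd; apply: contrapT => /(proj2 (bP v) x Dx).
pose m v := `[< d v <> Some (s i1 v) >].
have ok1 : ok m d i1.
  split=> // v; rewrite /m; case: asboolP => [nd|/contrapT //].
  split; last by move=> v'; apply: dlow; exists (b v').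
  by have [//|[/esym //|/(proj1 (bP v))]] := Otot (Some (s i1 v)) (d v).
pose i0 := pick (m, d).
have [[Si0 ok0] min0] := pickP (m, d) (ex_intro _ i1 ok1).
exists i0, i1, d, D'; split; split=> //.
- have [//|[ei|/(min0 _ ok1) //]] := RItot i0 i1.
  by case: ni1; exists (m, b).
- by move=> x; exists (Leaf (Some x)).
- by move=> v; exists (b v).
- by move=> v; exists (Node (m, v) b).
- by move=> v; exact: (proj1 (bP v)).
- by move=> v nd; have /= := ok0 v; rewrite /m asboolT.
- by move=> v ed; have /= := ok0 v; rewrite /m asboolF.
Qed.

Variables (J : Type) (Q : J -> J -> Prop) (Qst : strict_total Q).

(** Points are sorted by cut, then by the copy in [J] they belong to, then by their place in [W].
    The label [None] marks points common to all copies and puts them above the copies at the same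
    cut. *)
Definition stretched : option W * (option J * W) -> option W * (option J * W) -> Prop :=
  lexp (with_top R) (lexp (with_top Q) R).

Lemma stretched_strict_total : strict_total stretched.
Proof.
have [Rst _] := Rwo.
apply: lexp_strict_total; first exact: with_top_strict_total.
by apply: lexp_strict_total => //; exact: with_top_strict_total.
Qed.

(** A moving coordinate has its [i0]-value in [D'] and below [d v], hence below its [i1]-value, with
    both in the same gap. Labels [j] and [j'] reproduce this, while fixed coordinates carry no label
    and agree in all copies. *)
Lemma exists_stretched_pair : exists i0 i1
    (pos : J -> V -> option W * (option J * W)) (cpos : D -> option W * (option J * W)),
  [/\ S i0, S i1, RI i0 i1 & forall j j', Q j j' ->
    order_hom R stretched (sumf (sumf (s i0) (s i1)) c) (sumf (sumf (pos j) (pos j')) cpos)].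
Proof.
have [Ost _] := Owo; have [Oirr [Otr Otot]] := Ost.
have [Rst _] := Rwo; have [Rirr [Rtr Rtot]] := Rst.
have [i0 [i1 [d [D' [[Si0 Si1 i01 Dc Dd] [Ds0 s1d dlow mov fix0]]]]]] := exists_reflected_pair.
pose pos (j : J) v := (d v, (if `[< d v = Some (s i1 v) >] then None else Some j, s i1 v)).
pose cpos x := (Some (c x), (@None J, c x)).
exists i0, i1, pos, cpos; split=> // j j' jj'.
have d_le v : O (Some (s i1 v)) (d v) \/ d v = Some (s i1 v).
  by have [|[|/s1d]] := Otot (Some (s i1 v)) (d v); [left|right|].
have d_least x v : D' x -> O (Some (s i1 v)) x -> O (d v) x \/ d v = x.
  move=> Dx sx; have [|[|/(dlow _ _ Dx) xs]] := Otot (d v) x; [by left|by right|].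
  by case: (Oirr x); exact: Otr xs sx.
(* An entry of [s i1] that lies in [D'] is its own least upper element there, so it is fixed. *)
have dE v w : s i1 v = w -> D' (Some w) -> d v = Some w.
  move=> <- Dw; have [h|//] := d_le v; by case: (Oirr (Some (s i1 v))); exact: dlow.
have h1 k : order_hom R stretched (sumf (s i1) c) (sumf (pos k) cpos).
  split=> -[v|x] [v'|x'] /=.
  - move=> vv'; have [dv|[dv|dv]] := Otot (d v) (d v'); first by left.
      right; split=> //; rewrite /= -dv; case: asboolP => [dvv|_].
        by case: (s1d v'); rewrite -dv dvv.
      by case: asboolP => _; [left|right].
    case: (s1d v'); apply: Otr (dlow _ _ (Dd v') dv) _; exact: vv'.
  - move=> vx; have [|dv] := d_least _ _ (Dc x') (vx : O (Some _) (Some _)); first by left.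
    right; split=> //; left=> /=; case: asboolP => //= dvv.
    by move: vx; rewrite dvv in dv; case: dv => ->; move/Rirr.
  - move=> xv; left=> /=; have [h|->//] := d_le v'; exact: Otr (xv : O (Some _) (Some _)) h.
  - by left.
  - move=> vv'; suff dd : d v = d v' by rewrite /pos dd vv'.
    have [h|[//|h]] := Otot (d v) (d v').
      by case: (s1d v); rewrite vv'; exact: dlow.
    by case: (s1d v'); rewrite -vv'; exact: dlow.
  - by move=> vx; rewrite /pos /cpos vx (dE _ _ vx (Dc _)) asboolT.
  - by move=> /esym vx; rewrite /pos /cpos vx (dE _ _ vx (Dc _)) asboolT.
  - by rewrite /cpos => ->.
have h0 : order_hom R stretched (sumf (s i0) c) (sumf (pos j) cpos).
  have [g1 g2] := Shom Si0 Si1; have [k1 k2] := h1 j.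
  by split=> x y; [move=> /g1 /k1|move=> /g2 /k2].
(* The gap condition on [i0] excludes [d v'] below [d v]; at equal cuts, [j] precedes both [j'] and
   [None]. *)
have lt01 v v' : R (s i0 v) (s i1 v') -> stretched (pos j v) (pos j' v').
  move=> vv'; have vd : O (Some (s i0 v)) (d v').
    by have [h|->//] := d_le v'; exact: Otr (vv' : O (Some _) (Some _)) h.
  case: (pselect (d v = Some (s i1 v))) => [dv|ndv].
    by left; rewrite /= (fix0 _ dv).
  have [_ low] := mov _ ndv; have [h|[h|h]] := Otot (d v) (d v'); first by left.
    right; split=> //; left; rewrite /= (asboolF ndv).
    by case: asboolP.
  by case: (Oirr (d v')); exact: Otr (low _ h) vd.
(* As [s i0 v] is in [D'], leastness puts [d v'] at or below it. Equality of cuts is then possible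
   only for a fixed [v], whose label [None] is on top. *)
have gt01 v v' : R (s i1 v') (s i0 v) -> stretched (pos j' v') (pos j v).
  move=> vv'; have := d_least _ _ (Ds0 v) (vv' : O (Some _) (Some _)).
  case: (pselect (d v = Some (s i1 v))) => [dv|ndv].
    rewrite -(fix0 _ dv) => -[h|h]; first by left.
    right; split=> //; left; rewrite /= (asboolT dv); case: asboolP => //= dv'.
    by move: vv'; have := h; rewrite dv' (fix0 _ dv) => -[->] /Rirr.
  have [h _] := mov _ ndv; case=> [h'|e]; left=> /=; first exact: Otr h' h.
  by rewrite e.
have eq01 v v' : s i0 v = s i1 v' -> pos j v = pos j' v'.
  move=> vv'; have dv' : d v' = Some (s i0 v) by apply: dE.
  case: (pselect (d v = Some (s i1 v))) => [dv|ndv].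
    have e : s i1 v = s i1 v' by have := fix0 _ dv; rewrite dv vv' => -[].
    by rewrite /pos dv' -(fix0 _ dv) -e dv asboolT.
  have [h low] := mov _ ndv; rewrite -dv' in h.
  by case: (Oirr (d v')); rewrite {2}dv'; exact: low.
split=> -[[v|v]|x] [[v'|v']|x'] /=.
- exact: (proj1 h0 (inl v) (inl v')).
- exact: lt01.
- exact: (proj1 h0 (inl v) (inr x')).
- exact: gt01.
- exact: (proj1 (h1 j') (inl v) (inl v')).
- exact: (proj1 (h1 j') (inl v) (inr x')).
- exact: (proj1 h0 (inr x) (inl v')).
- exact: (proj1 (h1 j') (inr x) (inl v')).
- exact: (proj1 h0 (inr x) (inr x')).
- exact: (proj2 h0 (inl v) (inl v')).
- exact: eq01.
- exact: (proj2 h0 (inl v) (inr x')).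
- by move=> /esym /eq01.
- exact: (proj2 (h1 j') (inl v) (inl v')).
- exact: (proj2 (h1 j') (inl v) (inr x')).
- exact: (proj2 h0 (inr x) (inl v')).
- exact: (proj2 (h1 j') (inr x) (inl v')).
- exact: (proj2 h0 (inr x) (inr x')).
Qed.
End Stretching.

(** * Failure of the order property *)

Theorem theorem3p4 (t : vocab) (K : Str t -> Prop)
  (leK : forall N : Str t, (N -> Prop) -> Prop) (chi Lam : Type) :
  is_AEC K leK -> is_LS_number K leK chi -> card_lt chi Lam ->
  semisolvable K leK chi Lam ->
  forall (kappa mu : Type) (M : Str t), K M -> card_eq M Lam ->
  forall (I : Type) (R : I -> I -> Prop), well_order R ->
    is_succ_card I (kappa -> (mu + chi)%type) ->
    ~ order_property K leK M kappa mu R.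
Proof.
move=> aec [[nchi [_ _]] _] _ [Phi [EMs [EMi [[leS _] [EMf univ]]]]].
move=> kappa mu M KM [leML leLM] I RI RIwo [[_ nIX] _] [a [A [leA aop]]].
pose X := kappa -> (mu + chi)%type.
have [[_ [_ RItot]] _] := RIwo.
have Ibig : ~ small X (fun _ : I => True).
  by move=> [e ei]; apply: nIX; exists e => i j; exact: ei.
have ainj i j : a i = a j -> i = j.
  move=> e; have ne i' j' : a i' = a j' -> ~ RI i' j'.
    by move=> eij h; apply: (aop _ _ _ _ h h); rewrite eij; exact: Relation_Operators.rt_refl.
  by have [/ne|[//|/ne]] := RItot i j; rewrite e => /(_ erefl).
(* Over an empty [kappa] all the [a i] would coincide. *)
have [k0] : inhabited kappa.
  apply: contrapT => nk; have [i [j [_ _ []]]] :=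
    not_small_two (fun k => match nk (inhabits k) with end) Ibig.
  by apply: ainj; apply/funext => k; case: nk.
have nC : card_le nat (mu + chi)%type.
  by apply: (card_le_trans nchi); exists inr => x y [].
have leCX : card_le (mu + chi)%type X := card_le_const _ k0.
have nX : card_le nat X := card_le_trans nC leCX.
have leKX : card_le (kappa -> X) X := card_le_power_power nC k0.
have leSX : card_le (symbols (tauPhi Phi)) X.
  by apply: (card_le_trans leS); apply: card_le_trans leCX; exists inr => x y [].
have leAX : card_le {x | A x} X.
  by apply: (card_le_trans leA); apply: card_le_trans leCX; exists inl => x y [].
have nLX : ~ card_le Lam X.
  (* Otherwise the distinct sequences [a i] would embed [I] into [kappa -> X]. *)
  move=> leLX; apply: nIX; apply: card_le_trans leKX.
  by apply: card_le_trans (card_le_arrow kappa (card_le_trans leML leLX)); exists a.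
have leXL : card_le X Lam by have [|/nLX] := card_le_total X Lam.
have nL := card_le_trans nX leXL.
have [R Rwo] := exists_well_order Lam; have [Rst _] := Rwo.
have [KR [_ Runiv]] := univ Lam R Rst (conj (card_le_refl _) (card_le_refl _)).
have [g gk] := Runiv M KM (conj leML leLM).
have [p [s]] := EM_terms_pigeonhole EMf (fun i k => g (a i k)) Rst nX leSX leKX Ibig.
set V := ({k & 'I_(tag (p k))} : Type) in s *.
have leVX : card_le (V -> X) X := card_le_fun_tagged _ nX leKX.
have [pA [c cP]] := EM_terms EMf (fun x : {x | A x} => g (sval x)) Rst.
set D := ({e & 'I_(tag (pA e))} : Type) in c cP *.
have leDX : card_le D X by apply: card_le_tagged => // x; exact: card_le_fin.
move=> /(order_type_pigeonhole Rwo c s nX leDX leVX) [S [SP Sbig Shom]].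
have [J [Q [J0 [Qst leJL Jbig leJ0 Jdense]]]] := exists_order_with_small_dense_subset nX leXL nLX.
have [i0 [i1 [pos [cpos [Si0 Si1 i01 hom]]]]] :=
  exists_stretched_pair Rwo RIwo nX leDX leVX Sbig Shom Q.
have [[_ s0] [_ s1]] := (SP _ Si0, SP _ Si1).
pose T := stretched R Q; have Tst : strict_total T := stretched_strict_total Rwo Qst.
have [KT [cT _]] : universal_in K leK (reduct (EMs _ T)) Lam.
  apply: univ => //; split; last by exists (fun w => (None, (None, w))) => w w' [].
  apply: card_le_mull => //; first exact: card_le_option nL (card_le_refl _).
  exact: card_le_mull nL (card_le_option nL leJL) (card_le_refl _).
have [h hk] := Runiv _ KT cT.
pose v k m : V := existT _ k m; pose dA x m : D := existT _ x m.
(* [y] and [z] are the images, in the EM model over [Lam], of the stretched copies of the sequences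
   and of the parameters [A]. *)
pose y j k := h (teval (fun m => EMi _ T (pos j (v k m))) (tagged (p k))).
pose z x := h (teval (fun m => EMi _ T (cpos (dA x m))) (tagged (pA x))).
pose tv (e : V -> (V + V) + D) k := tmap (fun m => e (v k m)) (tagged (p k)).
pose tA x := tmap (fun m => inr (dA x m) : (V + V) + D) (tagged (pA x)).
(* The type is carried along [g] to the EM model of [R], from there to that of [T] by equality of
   order types, and back along [h]. The terms [tb] are left general so that the pair can be read in
   either order. *)
have stretch (b : kappa + kappa -> M) b' (tb : kappa + kappa -> term _ _) j j' : Q j j' ->
    (forall k, g (b k) = teval (fun x => EMi _ R (sumf (sumf (s i0) (s i1)) c x)) (tb k)) ->
    (forall k, b' k = h (teval (fun x => EMi _ T (sumf (sumf (pos j) (pos j')) cpos x)) (tb k))) ->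
    injective z /\ gtp_eq K leK (Triple (fun x : {x | A x} => sval x) b)
                                (@Triple t _ _ (reduct (EMs _ R)) z b').
  move=> jj' bE b'E; have [hom1 hom2] := hom _ _ jj'.
  have e1 x : g (sval x) = teval (fun x => EMi _ R (sumf (sumf (s i0) (s i1)) c x)) (tA x).
    by rewrite cP teval_tmap.
  have zE x : z x = h (teval (fun x => EMi _ T (sumf (sumf (pos j) (pos j')) cpos x)) (tA x)).
    by rewrite teval_tmap.
  have [|Tinj gtpT] := gtp_eq_EM EMf (qa := tA) tb aec Rst Tst hom1 hom2.
    by rewrite -(funext e1) => x x' /(proj1 (proj1 gk)) /sig_inj.
  split; first by move=> x x'; rewrite !zE => /(proj1 (proj1 hk)) /Tinj.
  apply: gtp_eq_trans (gtp_eq_kemb _ aec KM KR gk (@sig_inj _ _)) _.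
  rewrite (funext e1) (funext bE) (funext zE) (funext b'E).
  by apply: gtp_eq_trans gtpT _; exact: gtp_eq_kemb.
have yE (b b' : J) (u u' : V -> (V + V) + D) j j' :
    (forall x, sumf (sumf (pos j) (pos j')) cpos (u x) = pos b x) ->
    (forall x, sumf (sumf (pos j) (pos j')) cpos (u' x) = pos b' x) ->
    forall k, concat (y b) (y b') k =
      h (teval (fun x => EMi _ T (sumf (sumf (pos j) (pos j')) cpos x)) (sumf (tv u) (tv u') k)).
  move=> uE u'E [k|k]; rewrite /= teval_tmap; apply: (congr1 h);
    apply: (@eq_teval _ _ (EMs _ T)) => m;
    by rewrite ?uE ?u'E.
have aE i i' (u u' : V -> (V + V) + D) : S i -> S i' ->
    (forall x, sumf (sumf (s i0) (s i1)) c (u x) = s i x) ->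
    (forall x, sumf (sumf (s i0) (s i1)) c (u' x) = s i' x) ->
    forall k, g (concat (a i) (a i') k) =
      teval (fun x => EMi _ R (sumf (sumf (s i0) (s i1)) c x)) (sumf (tv u) (tv u') k).
  move=> /SP[_ si] /SP[_ si'] uE u'E [k|k]; rewrite /= teval_tmap ?si ?si'; apply: eq_teval => m;
    by rewrite ?uE ?u'E.
(* The parameters now also include the sequences [y b] for [b] in the dense set, still at most [X]
   elements. *)
pose Par := ({x | A x} + {b | J0 b} * kappa)%type.
pose par (e : Par) := match e with inl x => z x | inr bk => y (sval bk.1) bk.2 end.
have [p' [s' S'big]] := EM_terms_pigeonhole EMf y Rst nX leSX leKX Jbig.
set V' := ({k & 'I_(tag (p' k))} : Type) in s' S'big.
have [pP [cP' cP'E]] := EM_terms EMf par Rst.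
set D' := ({e & 'I_(tag (pP e))} : Type) in cP' cP'E.
have leD'X : card_le D' X.
  apply: card_le_tagged => // [|e]; last exact: card_le_fin.
  apply: card_le_addl => //; apply: card_le_mull => //.
  exact: card_le_fun_dom nX leKX.
have [S' [S'P S''big S'hom]] :=
  order_type_pigeonhole Rwo cP' s' nX leD'X (card_le_fun_tagged _ nX leKX) S'big.
have [j [j' [S'j S'j' jj']]] : exists j j', [/\ S' j, S' j' & Q j j'].
  have [x0 _] := nX; have [j [j' [Sj Sj' nj]]] := not_small_two (x0 0) S''big.
  have [_ [_ Qtot]] := Qst.
  by have [|[//|]] := Qtot j j'; [exists j, j'|exists j', j].
have [nJj yj] := S'P _ S'j; have [nJj' yj'] := S'P _ S'j'.
have [b [J0b jb bj']] := Jdense _ _ nJj nJj' jj'.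
have [hom1 hom2] := S'hom _ _ S'j S'j'.
pose tP (e : Par) := tmap (fun m => inr (existT _ e m) : V' + D') (tagged (pP e)).
pose tV k := tmap (fun m => inl (existT _ k m) : V' + D') (tagged (p' k)).
pose tb k := match k with inl k => tV k | inr k => tP (inr (exist _ b J0b, k)) end.
have zE i x : z x = teval (fun x => EMi _ R (sumf (s' i) cP' x)) (tP (inl x)).
  by rewrite teval_tmap -[z x]/(par (inl x)) cP'E.
have tbE i : (forall k, y i k = teval (fun m => EMi _ R (s' i (existT _ k m))) (tagged (p' k))) ->
    forall k, concat (y i) (y b) k = teval (fun x => EMi _ R (sumf (s' i) cP' x)) (tb k).
  move=> yi [k|k] /=; first by rewrite teval_tmap yi.
  by rewrite teval_tmap -[y b k]/(par (inr (exist _ b J0b, k))) cP'E.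
pose l : V -> (V + V) + D := fun x => inl (inl x).
pose r : V -> (V + V) + D := fun x => inl (inr x).
(* Since [j] is below [b], the pair [(y j, y b)] is read in increasing order. *)
have [zinj fwd] : injective z /\ gtp_eq K leK
    (Triple (fun x : {x | A x} => sval x) (concat (a i0) (a i1)))
    (@Triple t _ _ (reduct (EMs _ R)) z (concat (y j) (y b))).
  by apply: stretch jb _ _; [exact: (aE _ _ l r)|exact: (yE _ _ l r)].
(* Since [b] is below [j'], the pair [(y j', y b)] is read in decreasing order. *)
have [_ bwd] : injective z /\ gtp_eq K leK
    (Triple (fun x : {x | A x} => sval x) (concat (a i1) (a i0)))
    (@Triple t _ _ (reduct (EMs _ R)) z (concat (y j') (y b))).
  by apply: stretch bj' _ _; [exact: (aE _ _ r l)|exact: (yE _ _ r l)].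
(* [y j] and [y j'] use the same terms at tuples of the same order type over the parameters, [y b]
   among them. *)
have [|_ same] := gtp_eq_EM EMf (qa := fun x => tP (inl x)) tb aec Rst Rst hom1 hom2.
  by rewrite -(funext (zE j)).
rewrite -(funext (zE j)) -(funext (zE j')) -(funext (tbE _ yj)) -(funext (tbE _ yj')) in same.
apply: (aop _ _ _ _ i01 i01).
exact: gtp_eq_trans fwd (gtp_eq_trans same (gtp_eq_sym bwd)).
Qed.
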